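(* Let $J,H:\mathbb R^n\to\mathbb R$ be proper, convex, lower semi-continuous and absolutely one-homogeneous, let $\lambda>0$, $A\in\mathbb R^{m\times n}$, $f\in\mathbb R^m$. Suppose the differentiable function $u:[0,\infty)\to\mathbb R^n$ satisfies the flow $$u_t=-\lambda A^T(Au-f)-\frac{p-R(u)q}{H(u)},\qquad p(t)\in\partial J(u(t)),\ q(t)\in\partial H(u(t)).$$ Write uniquely $u(t)=v(t)+w(t)$ with $v(t)\in\mathrm{Ker}(A)$ and $w(t)\in(\mathrm{Ker}(A))^\perp$. If $v$ is uniformly bounded (i.e. $\sup_{t\ge0}\|v(t)\|_2<\infty$), then $u$ is uniformly bounded (i.e. $\sup_{t\ge0}\|u(t)\|_2<\infty$).
   Context: A functional $F:\mathbb R^n\to\mathbb R$ is absolutely one-homogeneous if $F(\alpha u)=|\alpha|F(u)$ for all $\alpha\in\mathbb R$, $u\in\mathbb R^n$. $R(u):=J(u)/H(u)$, and the flow is considered where $H(u(t))\ne 0$. $\partial$ denotes the convex subdifferential: $\partial F(u)=\{p: F(v)\ge F(u)+\langle p,v-u\rangle\ \forall v\in\mathbb R^n\}$. $u_t$ is the time derivative of $u$. *)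

(* Defs.v *)
From HB Require Import structures.
From mathcomp Require Export all_boot all_order all_algebra.
From mathcomp Require Export all_classical all_reals all_analysis.
From mathcomp Require Import lra.

Set Implicit Arguments.
Unset Strict Implicit.
Unset Printing Implicit Defensive.

Export Order.TTheory GRing.Theory Num.Theory.
Export numFieldNormedType.Exports.

Local Open Scope classical_set_scope.
Local Open Scope ring_scope.

Definition dotprod (R : realType) (n : nat) (x y : 'cV[R]_n) : R :=
  \sum_(i < n) x i 0 * y i 0.

(* MathComp-Analysis' norm `|x| on matrices is the sup norm, hence this
   separate Euclidean norm. *)
Definition norm2 (R : realType) (n : nat) (x : 'cV[R]_n) : R :=
  Num.sqrt (dotprod x x).

Definition proper_function (R : realType) (T : Type) (F : T -> \bar R) : Prop :=
  (exists x, F x < +oo)%E /\ (forall x, -oo < F x)%E.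

Definition abs_one_homogeneous (R : realType) (n : nat)
    (F : 'cV[R]_n -> R) : Prop :=
  forall (a : R) (u : 'cV[R]_n), F (a *: u) = `|a| * F u.

(* The functionals are real-valued, so `proper` and lower semicontinuity, both
   notions for extended real-valued functions, are read through EFin. *)
Definition admissible_functional (R : realType) (n : nat)
    (F : 'cV[R]_n -> R) : Prop :=
  [/\ proper_function (EFin \o F),
      convex_function setT F,
      lower_semicontinuous (EFin \o F) &
      abs_one_homogeneous F].

Definition subdifferential (R : realType) (n : nat) (F : 'cV[R]_n -> R)
    (u : 'cV[R]_n) : set 'cV[R]_n :=
  [set p | forall v, F u + dotprod p (v - u) <= F v].

Definition quotient_functional (R : realType) (n : nat)
    (J H : 'cV[R]_n -> R) (u : 'cV[R]_n) : R :=
  J u / H u.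

Definition Ker (R : realType) (m n : nat) (A : 'M[R]_(m, n)) : set 'cV[R]_n :=
  [set x | A *m x = 0].

Definition orthogonal_complement (R : realType) (n : nat)
    (S : set 'cV[R]_n) : set 'cV[R]_n :=
  [set x | forall y, S y -> dotprod x y = 0].

(* `d is the derivative at t of the restriction of u to [0, +oo[`: the usual
   derivative for t > 0 and the right derivative for t = 0.  The values of u
   at negative times are irrelevant. *)
Definition is_derive_half_line (R : realType) (n : nat) (u : R -> 'cV[R]_n)
    (t : R) (d : 'cV[R]_n) : Prop :=
  h^-1 *: (u (h + t) - u t) @[h --> within [set h | 0 <= h + t] 0^'] --> d.

Lemma is_derive_half_lineP (R : realType) (n : nat) (u : R -> 'cV[R]_n)
    (t : R) (d : 'cV[R]_n) :
  0 < t -> is_derive_half_line u t d <-> is_derive t 1 u d.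
Proof.
move=> t0.
have -> : is_derive_half_line u t d =
    (h^-1 *: ((u \o shift t) (h *: (1 : R)) - u t) @[h --> 0^'] --> d).
  rewrite /is_derive_half_line.
  have -> : within [set h | 0 <= h + t] (0 : R)^' = 0^'.
    apply/seteqP; split => P; last exact: cvg_within.
    rewrite /within/= => nP.
    have ge0 : \forall h \near (0 : R)^', 0 <= h + t.
      apply: nbhs_dnbhs; exists t => //= h /=.
      by rewrite sub0r normrN ltr_norml => /andP[]; lra.
    by apply: filterS2 nP ge0 => h; apply.
  suff -> : (fun h => h^-1 *: (u (h + t) - u t)) =
      (fun h => h^-1 *: ((u \o shift t) (h *: (1 : R)) - u t)) by [].
  by apply/funext => h; rewrite /= -[h *: 1]/(h * 1) mulr1.
split=> [ud|[ud <-]]; last exact: ud.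
by split; [apply/cvg_ex; exists d|exact: cvg_lim].
Qed.

Definition uniformly_bounded (R : realType) (n : nat)
    (u : R -> 'cV[R]_n) : Prop :=
  (ereal_sup [set (norm2 (u t))%:E | t in [set t : R | (0 <= t)%R]] < +oo)%E.

(* Main.v *)
Require Import Defs.
From mathcomp Require Import ring lra.

Set Implicit Arguments.
Unset Strict Implicit.
Unset Printing Implicit Defensive.

Local Open Scope classical_set_scope.
Local Open Scope ring_scope.

(** The subgradient part of the velocity is orthogonal to [u]: by Euler's
    identity ([subdifferential_dotprod]) the products of [p] and [q] with [u]
    are [J u] and [H u], so [p - R(u) q] has product [J u - R(u) * H u = 0]
    with [u].  Hence only the data term changes the length of [u]:
      (|u|^2)' = - 2 lambda <A u, A u - f> <= lambda (|f|^2 - |A u|^2).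
    On the orthogonal complement of the kernel, [A] is bounded below
    ([orthogonal_complement_Ker_coercive]): |w|^2 <= C |A w|^2, where
    [A w = A u].  As |u|^2 = |v|^2 + |w|^2 and |v|^2 <= M, this gives
      (|u|^2)' <= - (lambda / C) (|u|^2 - (M + C |f|^2)),
    and the Gronwall inequality ([gronwall_half_line]) bounds |u|^2 by the
    larger of |u(0)|^2 and M + C |f|^2.  Squared norms are used throughout,
    because they are differentiable also where [u] vanishes. *)

(** * The Euclidean inner product *)

Section DotProd.
Context {R : realType}.

Lemma dotprodE n (x y : 'cV[R]_n) : dotprod x y = (x^T *m y) 0 0.
Proof. by rewrite mxE; apply: eq_bigr => i _; rewrite mxE. Qed.

Lemma dotprodC n (x y : 'cV[R]_n) : dotprod x y = dotprod y x.
Proof. by apply: eq_bigr => i _; rewrite mulrC. Qed.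

Lemma dotprodDr n (x y z : 'cV[R]_n) :
  dotprod x (y + z) = dotprod x y + dotprod x z.
Proof. by rewrite !dotprodE mulmxDr mxE. Qed.

Lemma dotprodNr n (x y : 'cV[R]_n) : dotprod x (- y) = - dotprod x y.
Proof. by rewrite !dotprodE mulmxN mxE. Qed.

Lemma dotprodZr n a (x y : 'cV[R]_n) : dotprod x (a *: y) = a * dotprod x y.
Proof. by rewrite !dotprodE -scalemxAr mxE. Qed.

Lemma dotprodDl n (x y z : 'cV[R]_n) :
  dotprod (x + y) z = dotprod x z + dotprod y z.
Proof. by rewrite 3!(dotprodC _ z) dotprodDr. Qed.

Lemma dotprodZl n a (x y : 'cV[R]_n) : dotprod (a *: x) y = a * dotprod x y.
Proof. by rewrite 2!(dotprodC _ y) dotprodZr. Qed.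

Lemma dotprod_adjoint m n (A : 'M[R]_(m, n)) (x : 'cV[R]_n) (y : 'cV[R]_m) :
  dotprod x (A^T *m y) = dotprod (A *m x) y.
Proof. by rewrite !dotprodE mulmxA trmx_mul. Qed.

Lemma dotprod_ge0 n (x : 'cV[R]_n) : 0 <= dotprod x x.
Proof. by apply: sumr_ge0 => i _; rewrite -expr2 sqr_ge0. Qed.

Lemma dotprod_young n (s : R) (x y : 'cV[R]_n) : 0 < s ->
  2 * dotprod x y <= s^-1 * dotprod x x + s * dotprod y y.
Proof.
move=> s0; rewrite -subr_ge0.
have := dotprod_ge0 (x + (- s) *: y).
rewrite !(dotprodDl, dotprodDr, dotprodZl, dotprodZr) (dotprodC y x) => h.
have -> : s^-1 * dotprod x x + s * dotprod y y - 2 * dotprod x y =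
  s^-1 * (dotprod x x + - s * dotprod x y +
          (- s * dotprod x y + - s * (- s * dotprod y y))).
  by field; rewrite gt_eqF.
by apply: mulr_ge0; rewrite // invr_ge0 ltW.
Qed.

(** Every product of two coordinates of [x] is at most the squared norm of
    [x], so the sum of the moduli of the entries of [M] is a bound; adding 1
    makes it positive. *)
Lemma quadratic_form_bounded n (M : 'M[R]_n) :
  exists2 C : R, 0 < C & forall x : 'cV_n, dotprod x (M *m x) <= C * dotprod x x.
Proof.
have sqr_le (x : 'cV[R]_n) i : x i 0 ^+ 2 <= dotprod x x.
  rewrite /dotprod (bigD1 i) //= -expr2 lerDl.
  by apply: sumr_ge0 => j _; rewrite -expr2 sqr_ge0.
exists (1 + \sum_i \sum_j `|M i j|) => [|x].
  by rewrite ltr_pwDl // sumr_ge0 // => i _; rewrite sumr_ge0.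
rewrite mulrDl mul1r ler_wpDl ?dotprod_ge0 //.
rewrite mulr_suml; apply: ler_sum => i _.
rewrite mxE mulr_sumr mulr_suml; apply: ler_sum => j _.
rewrite mulrCA (le_trans (ler_norm _)) // normrM ler_wpM2l //.
have := sqr_le x i; have := sqr_le x j.
have := sqr_ge0 (x i 0 - x j 0); have := sqr_ge0 (x i 0 + x j 0).
by rewrite ler_norml => *; apply/andP; split; nra.
Qed.

(** A vector orthogonal to the kernel is orthogonal to the columns of the
    cokernel matrix of [A], so its transpose lies in the row space of [A].
    With [P] the transposed pseudo-inverse of [A] this means
    [w^T = (P *m w)^T *m A], so that |w|^2 = <P w, A w>.  Since
    |P w|^2 <= C |w|^2, Young's inequality with weight [C] leaves half of
    |w|^2 to be absorbed on the left. *)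
Lemma orthogonal_complement_Ker_coercive m n (A : 'M[R]_(m, n)) :
  exists2 C : R, 0 < C & forall w, orthogonal_complement (Ker A) w ->
    dotprod w w <= C * dotprod (A *m w) (A *m w).
Proof.
pose P := (pinvmx A)^T.
have [C C0 PC] := quadratic_form_bounded (P^T *m P).
exists C => // w w_orth.
have w_row : (w^T <= A)%MS.
  rewrite submxE; apply/eqP/matrixP => i j; rewrite [i]ord1 !mxE.
  transitivity (dotprod w (col j (cokermx A))).
    by apply: eq_bigr => k _; rewrite !mxE.
  by apply: w_orth; rewrite /Ker/= colE mulmxA mulmx_coker mul0mx.
have ww : dotprod w w = dotprod (P *m w) (A *m w).
  by rewrite !dotprodE trmx_mul trmxK mulmxA (mulmxKpV w_row).
have := dotprod_young (P *m w) (A *m w) C0; rewrite -ww.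
have : C^-1 * dotprod (P *m w) (P *m w) <= dotprod w w.
  rewrite mulrC ler_pdivrMr // mulrC.
  by rewrite -dotprod_adjoint mulmxA PC.
lra.
Qed.

End DotProd.

(** * Subgradients of one-homogeneous functionals *)

(** Euler's identity: testing the subgradient inequality at [0] and at
    [2 *: u] gives the two opposite bounds. *)
Lemma subdifferential_dotprod (R : realType) n (F : 'cV[R]_n -> R) u p :
  abs_one_homogeneous F -> subdifferential F u p -> dotprod u p = F u.
Proof.
move=> homF Fp; have := Fp 0; have := Fp (2 *: u).
have F0 : F 0 = 0 by rewrite -(scale0r u) homF normr0 mul0r.
have -> : 2 *: u - u = u by rewrite scaler_nat mulr2n addrK.
rewrite F0 homF ger0_norm // sub0r dotprodNr dotprodC; lra.
Qed.

(** * Calculus on the half-line *)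

Section HalfLine.
Context {R : realType}.

(** The function [exp (a t) (g t - K)] is nonincreasing, so the excess of [g]
    over [K] is at most its initial value if it is positive at all.  At time
    0 only continuity is asked, so that a one-sided derivative is enough. *)
Lemma gronwall_half_line (a K : R) (g dg : R -> R) : 0 <= a ->
  {within `[0, +oo[, continuous g} ->
  (forall t : R, 0 < t -> is_derive t 1 g (dg t)) ->
  (forall t : R, 0 < t -> dg t <= - a * (g t - K)) ->
  forall t : R, 0 <= t -> g t <= Num.max (g 0) K.
Proof.
move=> a0 gc gd dgle t t0.
pose h s := expR (a * s) * (g s - K).
have dh (s : R) : 0 < s ->
    is_derive s 1 h (expR (a * s) * dg s + (g s - K) * (a * expR (a * s))).
  move=> s0; have := gd s s0 => gs.
  have e1 : is_derive s 1 (fun s : R => expR (a * s)) (expR (a * s) * (a * 1)).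
    exact: (@is_derive1_comp _ expR ( *%R a)).
  have e2 : is_derive s 1 (fun s => g s - K) (dg s - 0) by exact: is_deriveB.
  apply: is_derive_eq (is_deriveM e1 e2) _.
  rewrite -[LHS]/(expR (a * s) * (dg s - 0) + (g s - K) * (expR (a * s) * (a * 1))).
  by ring.
have hle : h t <= h 0.
  apply: (ler0_derive1_nincry (a := 0)) => //.
  - by move=> s; rewrite in_itv/= andbT => /dh[].
  - move=> s; rewrite in_itv/= andbT => s0.
    have := dh s s0 => dhs; rewrite derive1E derive_val.
    have := dgle s s0; have := expR_gt0 (a * s); nra.
  - have ec : continuous (fun s => expR (a * s)).
      move=> z; apply: (@continuous_comp _ _ _ ( *%R a) expR).
        exact: mulrl_continuous.
      exact: continuous_expR.
    move=> s; apply: (@continuousM _ (subspace _) (fun s => expR (a * s))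
                                   (fun s => g s - K)).
      exact: continuous_subspaceT.
    by apply: continuousB; [exact: gc|exact: cst_continuous].
rewrite le_max; move: hle; rewrite /h mulr0 expR0 mul1r.
have e1 : 1 <= expR (a * t) by rewrite -expR0 ler_expR mulr_ge0.
case: (lerP (g t) K) => gK; rewrite ?orbT// orbF; nra.
Qed.

(** Near 0, [u h] is [u 0] plus [h] times the difference quotient, which
    converges. *)
Lemma is_derive_half_line0_cvg n (u : R -> 'cV[R]_n) d :
  is_derive_half_line u 0 d -> u t @[t --> 0^'+] --> u 0.
Proof.
move=> ud.
have q : h^-1 *: (u h - u 0) @[h --> (0 : R)^'+] --> d.
  apply: cvg_trans ud.
  have -> : (fun h => h^-1 *: (u (h + 0) - u 0)) =
            (fun h => h^-1 *: (u h - u 0)).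
    by apply/funext => h; rewrite addr0.
  apply: cvg_app => S nS; suff : \forall h \near (0 : R), 0 < h -> S h by [].
  have : \forall h \near (0 : R), h != 0 -> 0 <= h + 0 -> S h by [].
  by apply: filterS => h hS h0; apply: hS; rewrite ?addr0 ?gt_eqF ?ltW.
have : u 0 + h *: (h^-1 *: (u h - u 0)) @[h --> (0 : R)^'+] --> u 0 + 0 *: d.
  apply: cvgD; first exact: cvg_cst.
  apply: cvgZ q; exact: cvg_at_right_filter.
rewrite scale0r addr0; apply: cvg_trans; apply: near_eq_cvg.
near=> h; rewrite scalerA mulfV ?scale1r ?subrKC //.
Unshelve. all: by end_near.
Qed.

Lemma is_derive_dotprod n (u : R -> 'cV[R]_n) (t : R) d :
  is_derive t 1 u d ->
  is_derive t 1 (fun t => dotprod (u t) (u t)) (2 * dotprod (u t) d).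
Proof.
move=> [ud <-].
have di i : is_derive t 1 (fun t => u t i 0) ('D_1 u t i 0).
  split; first by move/derivable_mxP : ud; exact.
  by rewrite derive_mx // mxE.
have -> : (fun t => dotprod (u t) (u t)) =
    \sum_(i < n) ((fun t => u t i 0) * (fun t => u t i 0)).
  by apply/funext => s; rewrite fct_sumE.
apply: is_derive_eq.
rewrite /dotprod mulr_sumr; apply: eq_bigr => i _.
by rewrite /GRing.scale/=; ring.
Qed.

Lemma continuous_dotprod n (u : R -> 'cV[R]_n) :
  (forall t : R, 0 <= t -> exists d, is_derive_half_line u t d) ->
  {within `[0, +oo[, continuous (fun t => dotprod (u t) (u t))}.
Proof.
move=> ud; apply/continuous_within_itvcyP; split.
  move=> t; rewrite in_itv/= andbT => t0.
  have [d /(is_derive_half_lineP _ _ t0) dd] := ud t (ltW t0).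
  apply/differentiable_continuous/derivable1_diffP.
  by have [] := is_derive_dotprod dd.
have [d /is_derive_half_line0_cvg u0] := ud 0 (lexx 0).
apply: cvg_big => [|i _]; first exact: add_continuous.
have ui : u t i 0 @[t --> 0^'+] --> u 0 i 0.
  exact: (cvg_comp _ _ u0 (@coord_continuous _ _ _ i 0 (u 0))).
exact: cvgM.
Qed.

(** The time 0 makes the set of norms nonempty, so that a supremum below +oo
    is a real number. *)
Lemma uniformly_boundedP n (u : R -> 'cV[R]_n) :
  uniformly_bounded u <->
  exists M, forall t, 0 <= t -> dotprod (u t) (u t) <= M.
Proof.
have norm2K t : norm2 (u t) ^+ 2 = dotprod (u t) (u t).
  by rewrite sqr_sqrtr // dotprod_ge0.
split=> [|[M uM]].
  rewrite /uniformly_bounded; set S := ereal_sup _ => Sfin.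
  have Sub t : 0 <= t -> ((norm2 (u t))%:E <= S)%E.
    by move=> t0; apply: ereal_sup_ubound; exists t.
  have S_fin : S \is a fin_num.
    rewrite fin_numElt Sfin andbT (lt_le_trans _ (Sub 0 _)) ?ltNyr //.
  exists (fine S ^+ 2) => t t0; rewrite -norm2K.
  have nS : norm2 (u t) <= fine S by rewrite -lee_fin fineK // Sub.
  by rewrite lerXn2r ?nnegrE // ?(le_trans _ nS) // sqrtr_ge0.
apply: (@le_lt_trans _ _ (Num.sqrt M)%:E); last by rewrite ltry.
apply: ub_ereal_sup => _ [t t0 <-]; rewrite lee_fin.
exact/ler_wsqrtr/uM.
Qed.

End HalfLine.

(** * Boundedness of the flow *)

Unset Implicit Arguments.

Theorem corollary2 (R : realType) (m n : nat)
    (J H : 'cV[R]_n -> R)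
    (admJ : admissible_functional J) (admH : admissible_functional H)
    (lambda : R) (lambda_gt0 : 0 < lambda)
    (A : 'M[R]_(m, n)) (f : 'cV[R]_m)
    (u p q : R -> 'cV[R]_n)
    (H_neq0 : forall t : R, 0 <= t -> H (u t) != 0)
    (p_sub : forall t : R, 0 <= t -> subdifferential J (u t) (p t))
    (q_sub : forall t : R, 0 <= t -> subdifferential H (u t) (q t))
    (flow : forall t : R, 0 <= t ->
       is_derive_half_line u t
         (- (lambda *: (A^T *m (A *m u t - f)))
          - (H (u t))^-1 *: (p t - quotient_functional J H (u t) *: q t)))
    (v w : R -> 'cV[R]_n)
    (u_decomp : forall t : R, 0 <= t -> u t = v t + w t)
    (v_Ker : forall t : R, 0 <= t -> Ker A (v t))
    (w_Ker_orth : forall t : R, 0 <= t -> orthogonal_complement (Ker A) (w t)) :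
  uniformly_bounded v -> uniformly_bounded u.
Proof.
move=> /uniformly_boundedP[M vM]; apply/uniformly_boundedP.
have [_ _ _ homJ] := admJ; have [_ _ _ homH] := admH.
have [C C0 coercive] := orthogonal_complement_Ker_coercive A.
pose K := M + C * dotprod f f.
exists (Num.max (dotprod (u 0) (u 0)) K).
pose dg t := 2 * (- lambda * (dotprod (A *m u t) (A *m u t)
                              - dotprod (A *m u t) f)).
apply: (@gronwall_half_line _ (lambda / C) K _ dg).
- by rewrite divr_ge0 // ltW.
- by apply: continuous_dotprod => t t0; eexists; exact: flow.
(* The derivative of |u|^2: by Euler's identity the subgradients drop out. *)
- move=> t t0; have t0' := ltW t0.
  have /(is_derive_half_lineP _ _ t0)/is_derive_dotprod ud := flow t t0'.
  apply: is_derive_eq ud _; rewrite /dg; congr (2 * _).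
  rewrite !(dotprodDr, dotprodNr, dotprodZr) dotprod_adjoint.
  rewrite (subdifferential_dotprod homJ (p_sub t t0')).
  rewrite (subdifferential_dotprod homH (q_sub t t0')).
  rewrite /quotient_functional mulfVK ?H_neq0 // subrr mulr0 subr0.
  by rewrite dotprodDr dotprodNr mulNr.
- move=> t /ltW t0; rewrite /dg.
  have Au : A *m u t = A *m w t.
    by rewrite u_decomp // mulmxDr (v_Ker t t0) add0r.
  have uu : dotprod (u t) (u t) = dotprod (v t) (v t) + dotprod (w t) (w t).
    have wv := w_Ker_orth t t0 _ (v_Ker t t0).
    by rewrite u_decomp // !(dotprodDl, dotprodDr) (dotprodC (v t)) wv addr0 add0r.
  have := dotprod_young (A *m u t) f ltr01; rewrite invr1 !mul1r => young.
  have lower : C^-1 * (dotprod (u t) (u t) - K) <=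
               dotprod (A *m u t) (A *m u t) - dotprod f f.
    rewrite mulrC ler_pdivrMr // mulrC mulrBr.
    have := coercive _ (w_Ker_orth t t0); have := vM t t0.
    rewrite /K uu Au; lra.
  rewrite [- (lambda / C) * _]mulNr -mulrA; nra.
Qed.
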